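(* Let $G$ be a double-critical graph with $\chi(G)=6$. If $G$ is claw-free, then $G \cong K_6$.
   Context: All graphs are finite and simple. $V(G)$ and $E(G)$ denote the vertex set and edge set of $G$, and $\chi(G)$ denotes the chromatic number of $G$. For $x,y \in V(G)$, $G-x-y$ denotes the subgraph of $G$ induced by $V(G)\setminus\{x,y\}$. A connected graph $G$ with $\chi(G)=n$ is called double-critical (or $n$-double-critical) if $\chi(G-x-y)=n-2$ for every edge $xy\in E(G)$. A claw is a $4$-vertex graph with one vertex of degree $3$ and the other three of degree $1$ (i.e. $K_{1,3}$). A graph is claw-free if it has no claw as an induced subgraph. $K_n$ is the complete graph on $n$ vertices. *)

(* Defs.v *)
From mathcomp Require Import all_boot.

Set Implicit Arguments.
Unset Strict Implicit.
Unset Printing Implicit Defensive.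

Record sgraph := SGraph {
  vertex :> finType;
  adj : rel vertex;
  adj_sym : symmetric adj;
  adj_irr : irreflexive adj }.

Definition graph_iso (G H : sgraph) : Prop :=
  exists2 f : G -> H, bijective f & forall x y, adj (f x) (f y) = adj x y.

Section Induced.
Variables (G : sgraph) (A : {set G}).

Definition induced_adj : rel {x : G | x \in A} := relpre val (@adj G).

Lemma induced_adj_sym : symmetric induced_adj.
Proof. by move=> x y; apply: adj_sym. Qed.

Lemma induced_adj_irr : irreflexive induced_adj.
Proof. by move=> x; apply: adj_irr. Qed.

Definition induced : sgraph := SGraph induced_adj_sym induced_adj_irr.

End Induced.

Definition delete2 (G : sgraph) (x y : G) : sgraph := induced (~: [set x; y]).

Section Complete.
Variable n : nat.

Definition complete_adj : rel 'I_n := fun i j => i != j.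

Lemma complete_adj_sym : symmetric complete_adj.
Proof. by move=> i j; rewrite /complete_adj eq_sym. Qed.

Lemma complete_adj_irr : irreflexive complete_adj.
Proof. by move=> i; rewrite /complete_adj eqxx. Qed.

Definition complete_graph : sgraph := SGraph complete_adj_sym complete_adj_irr.

End Complete.

(* The centre of the claw is vertex 0 : two vertices are adjacent iff exactly
   one of them is the centre. *)
Definition claw_adj : rel 'I_4 := fun i j => (i == ord0) (+) (j == ord0).

Lemma claw_adj_sym : symmetric claw_adj.
Proof. by move=> i j; apply: addbC. Qed.

Lemma claw_adj_irr : irreflexive claw_adj.
Proof. by move=> i; apply: addbb. Qed.

Definition claw : sgraph := SGraph claw_adj_sym claw_adj_irr.

Definition claw_free (G : sgraph) : Prop :=
  forall A : {set G}, ~ graph_iso (induced A) claw.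

Definition colorable (G : sgraph) (k : nat) : bool :=
  [exists f : {ffun G -> 'I_k}, forall x, forall y, adj x y ==> (f x != f y)].

Lemma colorable_exists (G : sgraph) : exists k, colorable G k.
Proof.
exists #|G|; apply/existsP; exists [ffun x => enum_rank x].
apply/forallP => x; apply/forallP => y; apply/implyP => xy.
rewrite !ffunE (inj_eq enum_rank_inj).
by apply: contraTneq xy => ->; rewrite adj_irr.
Qed.

Definition chromatic_number (G : sgraph) : nat := ex_minn (colorable_exists G).

Definition connected_graph (G : sgraph) : Prop :=
  forall x y : G, connect (@adj G) x y.

(* The truncated subtraction is harmless: an edge forces the chromatic number
   to be at least 2. *)
Definition double_critical (G : sgraph) : Prop :=
  connected_graph G /\
  forall x y : G, adj x y ->
    chromatic_number (delete2 x y) = chromatic_number G - 2.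

(* Main.v *)
Require Import Defs.
From mathcomp Require Import all_boot.

Set Implicit Arguments.
Unset Strict Implicit.
Unset Printing Implicit Defensive.

(** Suppose that [G] is double-critical with chromatic number [k + 2] and that
    some vertex [x] has a non-neighbour; write [N] for the neighbourhood of
    [x].  The theorem comes from two opposite bounds on the size of [N].

    Both rest on an edge [w w'] that misses [x] and [N]
    ([edge_avoiding_nbhd]).  A [k]-colouring of [G - w - w'] colours [x], so
    [N] only sees the other [k - 1] colours ([card_nbhd_colors]).

    Upper bound ([claw_free_card_nbhd]): without claws, each colour occurs at
    most twice in [N], so [#|N| <= 2 (k - 1)].

    Lower bound ([card_nbhd_lower_bound]): the two ends of an edge have a
    common neighbour in every colour class once both ends are deleted
    ([common_nbr_of_color]), hence at least [k] common neighbours.  So [N] has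
    more than [k - 1] elements and two of them, [y] and [y'], share a colour.
    In a [k]-colouring of [G - x - y], some common neighbour [z] of [x] and
    [y] has the colour of [y'].  Thus [y] and [z] are non-neighbours of [y']
    in [N], and with the [k] common neighbours of [x] and [y'] this gives
    [#|N| >= k + 3].

    For [k = 4] the bounds read [7 <= #|N| <= 6].  Hence any two distinct
    vertices of [G] are adjacent, and a complete graph is determined by its
    chromatic number. *)

(** * Colourings and chromatic number *)

Lemma chromatic_number_leq (G : sgraph) (T : finType) (f : G -> T) :
  (forall u v, adj u v -> f u != f v) -> chromatic_number G <= #|T|.
Proof.
move=> f_proper; rewrite /chromatic_number; case: ex_minnP => m _; apply.
apply/existsP; exists [ffun v => enum_rank (f v)].
apply/forallP=> u; apply/forallP=> v; apply/implyP=> uv.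
by rewrite !ffunE (inj_eq enum_rank_inj) f_proper.
Qed.

Lemma chromatic_number_colorable (G : sgraph) :
  colorable G (chromatic_number G).
Proof. by rewrite /chromatic_number; case: ex_minnP. Qed.

(** Colourings of [G - x - y] are total functions on [G] with the value [None]
    at [x] and [y].  Since [None] then serves as a fresh colour, modifications
    of such a map are colourings of [G] with one more colour. *)
Definition coloring_off (G : sgraph) k (x y : G) (c : G -> option 'I_k) :=
  (forall v, (c v == None) = (v \in [set x; y])) /\
  (forall u v, adj u v -> c u = c v -> c u = None).

Lemma colorable_delete2 (G : sgraph) k (x y : G) :
  colorable (delete2 x y) k ->
  exists c : G -> option 'I_k, coloring_off x y c.
Proof.
case/existsP=> f /forallP f_proper.
exists (fun v => omap f (insub v : option (delete2 x y))); split=> [v|u v uv].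
  case: insubP => [a av _|] /=; first by rewrite inE in av; rewrite (negPf av).
  by rewrite inE negbK => ->.
case: insubP => [a _ eq_a|] //=; case: insubP => [b _ eq_b|] //= [eq_f].
have /forallP/(_ b) := f_proper a; rewrite eq_f eqxx implybF => /negP[].
by rewrite /= /induced_adj /= eq_a eq_b.
Qed.

(** * Neighbourhoods in double-critical graphs *)

Definition nbhd (G : sgraph) (x : G) : {set G} := [set y | adj x y].

Lemma connected_has_nbr (G : sgraph) (x z : G) :
  connected_graph G -> x != z -> exists y, adj x y.
Proof.
move=> /(_ x z) /connectP[[|y p] /=]; first by move=> _ -> /eqP[].
by case/andP=> xy _ _ _; exists y.
Qed.

Section DoubleCritical.

Variables (G : sgraph) (k : nat).
Hypotheses (dcG : double_critical G) (chiG : chromatic_number G = k.+2).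

Lemma edge_coloring (x y : G) :
  adj x y -> exists c : G -> option 'I_k, coloring_off x y c.
Proof.
move=> xy; apply: colorable_delete2.
by have := chromatic_number_colorable (delete2 x y);
  rewrite dcG.2 // chiG subn2.
Qed.

Lemma no_option_coloring (f : G -> option 'I_k) :
  ~ (forall u v, adj u v -> f u != f v).
Proof.
by move/chromatic_number_leq; rewrite chiG card_option card_ord ltnn.
Qed.

(** Otherwise one fresh colour would be enough for [G]: [x] takes it, together
    with the neighbours of [y] of colour [j], and [y] takes the colour [j],
    which is no longer in use around it. *)
Lemma common_nbr_of_color (x y : G) (c : G -> option 'I_k) (j : 'I_k) :
  adj x y -> coloring_off x y c ->
  exists z, [/\ adj x z, adj y z & c z = Some j].
Proof.
move=> xy [c_None c_proper].
have [/existsP[z /and3P[xz yz /eqP cz]]|no_z] :=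
  boolP [exists z, [&& adj x z, adj y z & c z == Some j]]; first by exists z.
have no_common v : adj x v -> adj y v -> c v = Some j -> False.
  by move=> xv yv cv; case/existsP: no_z; exists v; rewrite xv yv cv eqxx.
pose f v := if v == x then None else if v == y then Some j else
  if (c v == Some j) && adj y v then None else c v.
have cV v : v != x -> v != y -> c v <> None.
  by move=> vx vy /eqP; rewrite c_None !inE (negPf vx) (negPf vy).
case: (@no_option_coloring f).
(* A neighbour of [x] recoloured with [None] would be a common neighbour of
   [x] and [y] of colour [j]. *)
have f_x v : adj x v -> f v <> None.
  move=> xv; rewrite /f; case: eqP => [vx|/eqP vx].
    by rewrite vx adj_irr in xv.
  case: eqP => [//|/eqP vy]; case: andP => [[/eqP cv yv] _|_]; last exact: cV.
  exact: no_common xv yv cv.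
have f_y v : v != x -> adj y v -> f v <> Some j.
  move=> vx yv; rewrite /f (negPf vx); case: eqP => [vy|/eqP vy].
    by rewrite vy adj_irr in yv.
  by rewrite yv andbT; case: eqP.
move=> u v uv; apply/eqP=> f_uv; have vu : adj v u by rewrite adj_sym.
have [ux|ux] := eqVneq u x.
  by subst u; apply: (f_x v) => //; rewrite -f_uv /f eqxx.
have [vx|vx] := eqVneq v x.
  by subst v; apply: (f_x u) => //; rewrite f_uv /f eqxx.
have [uy|uy] := eqVneq u y.
  by subst u; apply: (f_y v) => //; rewrite -f_uv /f (negPf ux) eqxx.
have [vy|vy] := eqVneq v y.
  by subst v; apply: (f_y u) => //; rewrite f_uv /f (negPf vx) eqxx.
have c_uv : c u <> c v by move/(c_proper _ _ uv); apply: cV.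
move: f_uv; rewrite /f (negPf ux) (negPf vx) (negPf uy) (negPf vy).
case: andP => [[/eqP cu _]|_]; case: andP => [[/eqP cv _]|_] //.
- by rewrite cu cv in c_uv.
- by move/esym/(cV _ vx vy).
- by move/(cV _ ux uy).
Qed.

Lemma card_common_nbrs (x y : G) : adj x y -> k <= #|nbhd x :&: nbhd y|.
Proof.
move=> xy; have [c c_off] := edge_coloring xy.
have Some_k : injective (@Some 'I_k) by move=> i j [].
rewrite -[k in k <= _]card_ord -(card_imset _ Some_k).
apply: leq_trans (leq_imset_card c _); apply/subset_leq_card/subsetP.
move=> _ /imsetP[j _ ->]; have [z [xz yz <-]] := common_nbr_of_color j xy c_off.
by apply: imset_f; rewrite !inE xz yz.
Qed.

(** If all neighbours of a non-neighbour [w] of [x] were neighbours of [x],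
    then [w] could copy the colour of [x], while one deleted neighbour of [w]
    takes a fresh colour. *)
Lemma edge_avoiding_nbhd (x w : G) :
  x != w -> ~~ adj x w ->
  exists w', [/\ adj w w', x != w' & ~~ adj x w'].
Proof.
move=> xw xNw; have wx : w != x by rewrite eq_sym.
have [/existsP[w' /andP[ww' xNw']]|no_w'] :=
  boolP [exists w', adj w w' && ~~ adj x w'].
  exists w'; split=> //; apply: contraNneq xNw => eq_xw'.
  by rewrite eq_xw' adj_sym.
have sub_N v : adj w v -> adj x v.
  move=> wv; apply: contraNT no_w' => xNv; apply/existsP; exists v.
  by rewrite wv.
have [y wy] := connected_has_nbr dcG.1 wx.
have [c [c_None c_proper]] := edge_coloring wy.
have cV v : c v = None -> v = w \/ v = y.
  by move/eqP; rewrite c_None !inE => /orP[] /eqP; [left|right].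
have cx : c x <> None.
  case/cV=> [/eqP|xy]; first by rewrite (negPf xw).
  by have := sub_N _ wy; rewrite -xy adj_irr.
pose f v := if v == w then c x else c v.
case: (@no_option_coloring f).
have f_w v : adj w v -> c x <> f v.
  move=> wv; rewrite /f; case: eqP => [vw|_]; first by rewrite vw adj_irr in wv.
  by move/(c_proper _ _ (sub_N _ wv)).
move=> u v uv; apply/eqP=> f_uv; have vu : adj v u by rewrite adj_sym.
have [uw|uw] := eqVneq u w.
  by subst u; apply: (f_w v) => //; rewrite -f_uv /f eqxx.
have [vw|vw] := eqVneq v w.
  by subst v; apply: (f_w u) => //; rewrite f_uv /f eqxx.
move: f_uv; rewrite /f (negPf uw) (negPf vw) => c_uv.
have cu := c_proper _ _ uv c_uv.
have [/eqP|uy] := cV _ cu; first by rewrite (negPf uw).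
have [/eqP|vy] := cV v (etrans (esym c_uv) cu); first by rewrite (negPf vw).
by rewrite uy vy adj_irr in uv.
Qed.

(** Deleting the ends of the edge from [edge_avoiding_nbhd] leaves [x] and its
    neighbourhood intact, and in a [k]-colouring of the rest the colour of [x]
    does not occur on that neighbourhood. *)
Lemma card_nbhd_colors (x w : G) :
  x != w -> ~~ adj x w ->
  exists c : G -> option 'I_k,
    {in nbhd x &, forall u v, adj u v -> c u <> c v} /\
    #|c @: nbhd x| <= k.-1.
Proof.
move=> xw xNw; have [w' [ww' xw' xNw']] := edge_avoiding_nbhd xw xNw.
have [c [c_None c_proper]] := edge_coloring ww'.
have c_N v : v \in nbhd x -> c v <> None.
  rewrite inE => xv /eqP; rewrite c_None !inE => /orP[] /eqP vw; subst v.
    by rewrite xv in xNw.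
  by rewrite xv in xNw'.
have cx : c x != None by rewrite c_None !inE negb_or xw.
exists c; split=> [u v uN _ uv|]; first by move/(c_proper _ _ uv)/c_N; apply.
have colors : c @: nbhd x \subset ~: [set None; c x].
  apply/subsetP=> _ /imsetP[v vN ->]; rewrite !inE negb_or.
  apply/andP; split; apply/eqP; first exact: c_N.
  move=> cv; case: (c_N v vN).
  by apply: (c_proper v x) => //; rewrite adj_sym; move: vN; rewrite inE.
apply: leq_trans (subset_leq_card colors) _.
rewrite -(leq_add2l #|[set None; c x]|) cardsC card_option card_ord cards2.
by rewrite eq_sym cx; case: (k).
Qed.

Lemma card_nbhd_lower_bound (x w : G) :
  x != w -> ~~ adj x w -> k.+3 <= #|nbhd x|.
Proof.
move=> xw xNw; have [c [c_proper c_colors]] := card_nbhd_colors xw xNw.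
have [y0 xy0] := connected_has_nbr dcG.1 xw.
have ltkN : k < #|nbhd x|.
  apply: leq_ltn_trans (card_common_nbrs xy0) _; apply: proper_card.
  apply/properP; split; first exact: subsetIl.
  by exists y0; rewrite !inE ?adj_irr ?andbF.
(* Two neighbours of [x] share a colour, hence are not adjacent. *)
have [/dinjectiveP c_inj|/dinjectivePn[y yN [y']]] :=
  boolP (dinjectiveb c (nbhd x)).
  move: ltkN; rewrite -(card_in_imset c_inj) ltnNge.
  by rewrite (leq_trans c_colors) // leq_pred.
rewrite !inE => /andP[y'y xy'] c_yy'.
have xy : adj x y by rewrite inE in yN.
have y'Ny : ~~ adj y' y.
  by apply/negP=> /c_proper; rewrite !inE c_yy' => /(_ xy' xy).
have [d [d_None d_proper]] := edge_coloring xy.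
case d_y' : (d y') => [j|]; last first.
  move/eqP: d_y'; rewrite d_None !inE (negPf y'y) orbF => /eqP y'x.
  by rewrite y'x adj_irr in xy'.
have [z [xz yz dz]] := common_nbr_of_color j xy (conj d_None d_proper).
have y'Nz : ~~ adj y' z.
  by apply/negP=> /d_proper; rewrite d_y' dz => /(_ erefl).
have y'z : y' != z by apply: contraNneq y'Ny => ->; rewrite adj_sym.
have zy : z != y by apply: contraTneq yz => ->; rewrite adj_irr.
have disj : [disjoint [set y'; y; z] & nbhd x :&: nbhd y'].
  rewrite disjoint_subset; apply/subsetP=> v; rewrite !inE => /orP[/orP[]|].
  - by move/eqP->; rewrite adj_irr andbF.
  - by move/eqP->; rewrite (negPf y'Ny) andbF.
  - by move/eqP->; rewrite (negPf y'Nz) andbF.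
have card3 : #|[set y'; y; z]| = 3.
  by rewrite setUC cardsU1 cards2 !inE negb_or eq_sym y'z zy y'y.
have sub : [set y'; y; z] :|: (nbhd x :&: nbhd y') \subset nbhd x.
  rewrite subUset subsetIl andbT; apply/subsetP=> v; rewrite !inE.
  by case/orP=> [/orP[]|] /eqP->.
apply: leq_trans (subset_leq_card sub).
have := leq_card_setU [set y'; y; z] (nbhd x :&: nbhd y').
case=> _; rewrite disj => /eqP->.
by rewrite card3 -[k.+3]/(3 + k) leq_add2l card_common_nbrs.
Qed.

End DoubleCritical.

(** * Claws *)

Lemma graph_iso_induced_imset (G H : sgraph) (g : H -> G) :
  injective g -> (forall i j, adj (g i) (g j) = adj i j) ->
  graph_iso (induced (g @: [set: H])) H.
Proof.
move=> g_inj g_adj.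
pose h i : induced (g @: [set: H]) := exist _ (g i) (imset_f g (in_setT i)).
have h_inj : injective h by move=> i j /(congr1 val) /g_inj.
have [|f hK fK] := inj_card_bij h_inj.
  by rewrite card_sig (card_imset _ g_inj) cardsT.
exists f; first by exists h.
by move=> u v; rewrite -g_adj -[u in RHS]fK -[v in RHS]fK.
Qed.

Lemma claw_free_independent (G : sgraph) (x : G) (S : {set G}) :
  claw_free G -> S \subset nbhd x -> {in S &, forall u v, ~~ adj u v} ->
  #|S| <= 2.
Proof.
move=> noclaw /subsetP SN S_ind; rewrite leqNgt.
apply/negP=> /card_gt2P[a [b [d [[aS bS dS] [ab bd da]]]]].
have [xa xb xd] : [/\ adj x a, adj x b & adj x d].
  by have := (SN _ aS, SN _ bS, SN _ dS); rewrite !inE => -[[-> ->] ->].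
have x_neq v : adj x v -> x != v.
  by move=> xv; apply: contraTneq xv => ->; rewrite adj_irr.
have s_uniq : uniq [:: x; a; b; d].
  by rewrite /= !inE !negb_or !x_neq // ab bd eq_sym da.
pose g (i : claw) := nth x [:: x; a; b; d] i.
apply: (noclaw (g @: [set: claw])); apply: graph_iso_induced_imset.
  by move=> i j /eqP; rewrite nth_uniq // => /eqP/val_inj.
have ind u v : u \in S -> v \in S -> adj u v = false.
  by move=> uS vS; apply/negbTE/S_ind.
have nbr v : adj x v -> (adj x v = true) * (adj v x = true).
  by move=> xv; rewrite [adj v x]adj_sym.
have [[xa2 xb2] xd2] := (nbr _ xa, nbr _ xb, nbr _ xd).
by case=> [[|[|[|[|i]]]] lt_i] // [[|[|[|[|j]]]] lt_j] //;
  rewrite /g /= /claw_adj /= ?adj_irr ?xa2 ?xb2 ?xd2 ?ind.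
Qed.

Lemma claw_free_card_nbhd (G : sgraph) k (x w : G) :
  double_critical G -> chromatic_number G = k.+2 -> claw_free G ->
  x != w -> ~~ adj x w -> #|nbhd x| <= 2 * k.-1.
Proof.
move=> dcG chiG noclaw xw xNw.
have [c [c_proper c_colors]] := card_nbhd_colors dcG chiG xw xNw.
apply: leq_trans (leq_mul (leqnn 2) c_colors).
rewrite -sum1_card (partition_big_imset c) /= mulnC -sum_nat_const.
apply: leq_sum => j _; rewrite sum1dep_card.
apply: (@claw_free_independent _ x) => //.
  by apply/subsetP=> v; rewrite inE => /andP[].
move=> u v; rewrite inE => /andP[uN /eqP cu]; rewrite inE => /andP[vN /eqP cv].
by apply/negP=> /(c_proper _ _ uN vN); rewrite cu cv.
Qed.

(** * Complete graphs *)

Lemma complete_graph_iso (G : sgraph) :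
  (forall x y : G, x != y -> adj x y) ->
  graph_iso G (complete_graph (chromatic_number G)).
Proof.
move=> G_complete.
have adjE (x y : G) : adj x y = (x != y).
  by apply/idP/idP=> [|/G_complete//]; apply: contraTneq => ->; rewrite adj_irr.
have /existsP[f /forallP f_proper] := chromatic_number_colorable G.
have f_inj : injective f.
  move=> x y f_xy; apply/eqP; apply: contraTT isT => xy.
  by have /forallP/(_ y) := f_proper x; rewrite adjE xy f_xy eqxx.
exists f; last by move=> x y; rewrite adjE /= /complete_adj (inj_eq f_inj).
apply: inj_card_bij f_inj _; rewrite card_ord.
by apply: (@chromatic_number_leq G G id) => x y; rewrite adjE.
Qed.

Theorem theorem1p2 (G : sgraph) (hG : double_critical G)
  (hchi : chromatic_number G = 6) (hclaw : claw_free G) :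
  graph_iso G (complete_graph 6).
Proof.
rewrite -hchi; apply: complete_graph_iso => x y xy.
apply/negPn/negP=> xNy.
have := leq_trans (card_nbhd_lower_bound hG hchi xy xNy)
                  (claw_free_card_nbhd hG hchi hclaw xy xNy).
by [].
Qed.
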